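(* Let $M$ be a connected matroid with cycle system $\mathcal{C}=\{C_1,\dots,C_g\}$. Then $\{C_1,\dots,C_g\}$ is a basis for the circuit space of $M$.
   Context: Matroids are on finite ground sets; $E(M)$ is the ground set and $r(M)$ the rank. A set is dependent if it is not independent. A cycle of $M$ is a subset of $E(M)$ that can be expressed as a union of circuits. The corank of $M$ is $g=|E(M)|-r(M)$. For subsets $A_1,\dots,A_k$ of a set $E$ and $S\subseteq[k]=\{1,\dots,k\}$, the unique union $\mathcal{A}_S=\ast\{A_i: i\in S\}$ is the set of elements of $E$ that belong to exactly one of the sets $A_i$, $i\in S$. A cycle system on a matroid $M$ of corank $g$ is a collection $\mathcal{C}=\{C_1,\dots,C_g\}$ of $g$ cycles of $M$ such that for every nonempty $S\subseteq[g]$ the unique union $\mathcal{C}_S=\ast\{C_i:i\in S\}$ is dependent in $M$. The circuit space of $M$ is the subspace of $\mathbb{F}_2^{E(M)}$ spanned by the indicator vectors of the circuits of $M$; a subset of $E(M)$ is identified with its indicator vector in $\mathbb{F}_2^{E(M)}$, so that addition is symmetric difference. *)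

(* Defs.v *)
From HB Require Import structures.
From mathcomp Require Import all_boot all_order all_algebra.

Set Implicit Arguments.
Unset Strict Implicit.
Unset Printing Implicit Defensive.

Import GRing.Theory.
Local Open Scope ring_scope.

(* The ground set of [M : matroid E] is the whole finite type [E]. *)
Record matroid (E : finType) := Matroid {
  indep : {set {set E}};
  indep_set0 : set0 \in indep;
  indep_sub : forall I J : {set E}, J \in indep -> I \subset J -> I \in indep;
  indep_augment : forall I J : {set E}, I \in indep -> J \in indep ->
    (#|I| < #|J|)%N -> exists2 e, e \in J :\: I & e |: I \in indep
}.

Section MatroidNotions.
Variables (E : finType) (M : matroid E).
Implicit Types (A : {set E}).

Definition dependent A : bool := A \notin indep M.

Definition rank : nat := (\max_(I in indep M) #|I|)%N.

(* The subtraction does not truncate, since rank <= #|E|. *)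
Definition corank : nat := (#|E| - rank)%N.

Definition circuits : {set {set E}} := [set A | minset dependent A].

(* The empty union is allowed, so set0 is a cycle. *)
Definition is_cycle A : Prop :=
  exists2 F : {set {set E}}, F \subset circuits & A = cover F.

Definition connected : Prop :=
  forall x y : E, x != y ->
    exists2 D : {set E}, D \in circuits & (x \in D) && (y \in D).

Definition unique_union (g : nat) (C : 'I_g -> {set E}) (S : {set 'I_g}) :
  {set E} := [set x | #|[set i in S | x \in C i]| == 1%N].

(* The members of a cycle system are automatically distinct: if C i = C j with
   i != j, then the unique union over {i, j} is empty, hence independent. *)
Definition cycle_system (g : nat) (C : 'I_g -> {set E}) : Prop :=
  [/\ g = corank,
      forall i, is_cycle (C i)
    & forall S : {set 'I_g}, S != set0 -> dependent (unique_union C S)].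

(* The codomain is ('F_2)^o rather than 'F_2 so that the function space gets its
   vector space structure over 'F_2. *)
Definition indicator A : {ffun E -> ('F_2)^o} := [ffun x => (x \in A)%:R].

Definition circuit_space : {vspace {ffun E -> ('F_2)^o}} :=
  <<[seq indicator D | D in circuits]>>%VS.

End MatroidNotions.

(* Main.v *)
Require Import Defs.
From HB Require Import structures.
From mathcomp Require Import all_boot all_order all_algebra.

Set Implicit Arguments.
Unset Strict Implicit.
Unset Printing Implicit Defensive.

Import GRing.Theory.

(** Let W be the span over F_2 of the indicators of the C i. A combination of
    the C i over a nonempty index set S is nonzero at every element lying in
    exactly one C i with i in S, so its support contains the unique union of
    S and is dependent. In particular it is nonzero: the C i are independent,
    W has dimension equal to the corank of M, and every nonzero word of W has a
    support which is dependent in M.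

    The rest concerns any such W and does not mention cycle systems. Let M_W
    be the binary matroid in which a set is dependent when it contains the
    support of a nonzero word of W. It has the corank of M, and every base of M
    is a base of M_W, that is, M is a rank-preserving weak-map image of M_W.
    A theorem of Lucas says that a connected weak-map image of a binary
    matroid of the same rank is that matroid, so W is the circuit space of M.

    Lucas's theorem is proved here through fundamental circuits. Fix a base B
    of M and e outside B. Counting dimensions gives a word w of W whose only
    coordinate outside B is e ([fundamental_word]), and the circuit K of M
    inside e |: B is contained in the support of w ([circuit_sub_word]). It
    remains to see that w has no further element f ([fundamental_word_sub]).
    By connectedness some circuit D contains e and f, and one inducts on the
    number of elements of D outside B: a base exchange or a circuit
    elimination makes that number smaller, except in one configuration, where
    two rows and two columns of the fundamental matrix read
      1 1        1 1
      0 1   and  1 1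
    for M and for W. The first is the pattern of a base of M, while the second
    is singular over F_2, so that base supports a nonzero word.

    Once the fundamental words are the fundamental circuits, every circuit is a
    word of W, since it is fundamental for some base, and every word is a sum
    of fundamental circuits ([weak_map_circuit_space]). *)

(** * Circuits, elimination and bases of a matroid *)

Section Independence.
Variables (E : finType) (M : matroid E).
Implicit Types (A B D I J K X : {set E}) (x y e f b : E).

Lemma dependentS A B : A \subset B -> dependent M A -> dependent M B.
Proof. by move=> sAB; apply: contra => iB; apply: indep_sub sAB. Qed.

Lemma circuit_dep K : K \in circuits M -> dependent M K.
Proof. by rewrite inE => /minsetp. Qed.

Lemma circuit_sub K A :
  K \in circuits M -> A \subset K -> dependent M A -> A = K.
Proof. by rewrite inE => /minsetinf H sAK dA; apply: H. Qed.

Lemma circuitD1_indep K y : K \in circuits M -> y \in K -> K :\ y \in indep M.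
Proof.
move=> cK yK; apply/negPn/negP => dKy.
by move: yK; rewrite -(circuit_sub cK (subsetDl K [set y]) dKy) setD11.
Qed.

Lemma circuitNindep K I :
  K \in circuits M -> I \in indep M -> K \subset I -> False.
Proof.
move=> cK iI sKI; have := dependentS sKI (circuit_dep cK).
by rewrite /dependent iI.
Qed.

Lemma dep_circuit A :
  dependent M A -> exists2 K, K \in circuits M & K \subset A.
Proof. by case/minset_exists=> K mK sKA; exists K; rewrite ?inE. Qed.

Lemma indep_extend I J :
    I \in indep M -> J \in indep M -> #|I| <= #|J| ->
  exists I', [/\ I' \in indep M, I \subset I', I' \subset I :|: J
               & #|I'| = #|J| ].
Proof.
move=> + iJ; move En: (#|J| - #|I|) => n.
elim: n I En => [|n IHn] I En iI leIJ.
  exists I; split=> //; first exact: subsetUl.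
  by apply/eqP; rewrite eqn_leq leIJ -subn_eq0 En.
have ltIJ : #|I| < #|J| by rewrite -subn_gt0 En.
have [e /setDP[eJ eI] ieI] := indep_augment iI iJ ltIJ.
have cI : #|e |: I| = #|I|.+1 by rewrite cardsU1 eI.
have [|||I' [iI' sI sI' cI']] := IHn (e |: I) => //; rewrite ?cI //.
  by rewrite subnS En.
exists I'; split=> //; first exact: subset_trans (subsetUr _ _) sI.
apply: subset_trans sI' _; rewrite -setUA subUset subxx sub1set.
by rewrite inE eJ orbT.
Qed.

(** This is transitivity of closure, in the form in which all exchange
    properties below use it: if I spans X, a circuit K through y with the rest
    of K in X shows that I spans y. Otherwise K :\ y would extend, using
    elements of y |: I, to an independent set inside X :|: I larger than I. *)
Lemma span_circuit I X K y :
    I \in indep M ->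
    (forall x, x \in X -> x \notin I -> dependent M (x |: I)) ->
    K \in circuits M -> y \in K -> K :\ y \subset X -> y \notin I ->
  dependent M (y |: I).
Proof.
move=> iI spanX cK yK sKX yI; apply/negP => iyI.
have iKy := circuitD1_indep cK yK.
have leK : #|K :\ y| <= #|y |: I|.
  rewrite leqNgt; apply/negP => ltK.
  have [x /setDP[xK]] := indep_augment iyI iKy ltK.
  rewrite !inE negb_or => /andP[xy xI] ixyI.
  have /negP := spanX x (subsetP sKX x xK) xI; apply.
  by apply: indep_sub ixyI _; apply: setUS; apply: subsetUr.
have [J [iJ sKJ sJ cJ]] := indep_extend iKy iyI leK.
have yJ : y \notin J.
  apply/negP => yJ; apply: (circuitNindep cK iJ).
  by rewrite -(setD1K yK) subUset sub1set yJ.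
have ltIJ : #|I| < #|J| by rewrite cJ cardsU1 yI.
have [x /setDP[xJ xI] ixI] := indep_augment iI iJ ltIJ.
have xX : x \in X.
  have := subsetP sJ x xJ; rewrite in_setU in_setU1 (negPf xI) orbF.
  case/orP=> [/(subsetP sKX)//|/eqP xy]; by rewrite -xy xJ in yJ.
by have := spanX x xX xI; rewrite /dependent ixI.
Qed.

(** If the exchanged set were dependent, then I :\ b would span e, hence also b
    through the circuit K, although I is independent. *)
Lemma circuit_exchange I K e b :
    I \in indep M -> e \notin I -> K \in circuits M -> K \subset e |: I ->
    b \in K ->
  (e |: I) :\ b \in indep M.
Proof.
move=> iI eI cK sK bK; have [->|neb] := eqVneq b e; first by rewrite setU1K.
have bI : b \in I by have := subsetP sK b bK; rewrite !inE (negPf neb).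
apply/negPn/negP => dIb.
have /negP : dependent M (b |: I :\ b); last by rewrite setD1K.
apply: (@span_circuit _ ((e |: I) :\ b) K) => //.
- by apply: indep_sub iI (subsetDl _ _).
- move=> x; rewrite !inE => /andP[xb /orP[/eqP->|xI]].
    move=> _; apply: dependentS dIb; apply/subsetP=> y.
    by rewrite !inE => /andP[-> ->].
  by rewrite xb xI.
- exact: setSD.
- by rewrite setD11.
Qed.

Lemma maximal_indep X : exists I,
  [/\ I \in indep M, I \subset X
    & forall x, x \in X -> x \notin I -> dependent M (x |: I)].
Proof.
have [|I /maxsetP[/andP[iI sI] maxI] _] :=
  @maxset_exists _ (fun A => (A \in indep M) && (A \subset X)) set0.
  by rewrite indep_set0 sub0set.
exists I; split=> // x xX xI; apply/negP => ixI.
have := maxI (x |: I); rewrite ixI subUset sub1set xX sI subsetUr => eqI.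
by move: xI; rewrite -eqI // setU11.
Qed.

(** A maximal independent subset I of (D :|: K) :\ x :\ e spans x through K,
    and then e through D, so e lies on a circuit inside e |: I. *)
Lemma strong_elimination D K x e :
    D \in circuits M -> K \in circuits M -> x \in D -> x \in K ->
    e \in D -> e \notin K ->
  exists D', [/\ D' \in circuits M, e \in D' & D' \subset (D :|: K) :\ x].
Proof.
move=> cD cK xD xK eD eK.
have nex : e != x by apply: contraNneq eK => ->.
have [I [iI sI maxI]] := maximal_indep ((D :|: K) :\ x :\ e).
have [xI eI] : x \notin I /\ e \notin I.
  by split; apply/negP => /(subsetP sI); rewrite !inE eqxx ?andbF.
have dxI : dependent M (x |: I).
  apply: (span_circuit iI maxI cK xK _ xI); apply/subsetP=> y.
  rewrite !inE => /andP[-> yK]; rewrite yK orbT !andbT.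
  by apply: contraNneq eK => <-.
have deI : dependent M (e |: I).
  apply: (@span_circuit I ((D :|: K) :\ e) D) => //.
    move=> y yX; have [->//|nyx] := eqVneq y x.
    by apply: maxI; rewrite !inE nyx; move: yX; rewrite !inE.
  by apply: setSD; apply: subsetUl.
have [D' cD' sD'] := dep_circuit deI; exists D'; split=> //.
  apply/negPn/negP => eD'; apply: (circuitNindep cD' iI).
  apply/subsetP=> y yD'; have := subsetP sD' y yD'.
  by rewrite !inE => /orP[/eqP eq_ye|//]; rewrite -eq_ye yD' in eD'.
apply: subset_trans sD' _; rewrite subUset sub1set !inE nex eD /=.
exact: subset_trans sI (subsetDl _ _).
Qed.

Definition base B := (B \in indep M) && (#|B| == rank M).

Lemma base_indep B : base B -> B \in indep M.
Proof. by case/andP. Qed.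

Lemma indep_leq_rank I : I \in indep M -> #|I| <= rank M.
Proof.
by move=> iI; apply: (@leq_bigmax_cond _ (mem (indep M)) (fun J => #|J|)). Qed.

Lemma base_extend I : I \in indep M -> exists2 B, base B & I \subset B.
Proof.
move=> iI; have [J iJ rJ] : exists2 J, J \in indep M & rank M = #|J|.
  have [|J iJ rJ] := @eq_bigmax_cond _ (mem (indep M)) (fun J => #|J|).
    by apply/card_gt0P; exists I.
  by exists J.
have [|B [iB sIB _ cB]] := indep_extend iI iJ.
  by rewrite -rJ indep_leq_rank.
by exists B => //; rewrite /base iB cB rJ eqxx.
Qed.

Lemma card_base B : base B -> #|~: B| = corank M.
Proof. by case/andP=> _ /eqP cB; rewrite cardsCs setCK cB. Qed.

Lemma base_circuit B e : base B -> e \notin B ->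
  exists2 K, K \in circuits M & K \subset e |: B.
Proof.
case/andP=> _ /eqP cB eB; apply: dep_circuit; apply/negP => ieB.
by have := indep_leq_rank ieB; rewrite cardsU1 eB cB ltnn.
Qed.

Lemma base_exchange B K e b :
    base B -> e \notin B -> K \in circuits M -> K \subset e |: B -> b \in K ->
  base ((e |: B) :\ b).
Proof.
case/andP=> iB /eqP cB eB cK sK bK.
rewrite /base (circuit_exchange iB eB cK sK bK) /=.
have := cardsD1 b (e |: B); rewrite (subsetP sK b bK) cardsU1 eB cB /= !add1n.
by case=> ->.
Qed.

Lemma base_circuitE B K e :
  base B -> K \in circuits M -> K \subset e |: B -> e \in K.
Proof.
move=> bB cK sK; apply/negPn/negP => eK.
apply: (circuitNindep cK (base_indep bB)); apply/subsetP=> y yK.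
have := subsetP sK y yK; rewrite !inE => /orP[/eqP eq_ye|//].
by rewrite -eq_ye yK in eK.
Qed.

(** If no element x of D outside B could replace f in B, then B :\ f would
    span D :\ f, hence also f through the circuit D. *)
Lemma circuit_through B D f :
    base B -> f \in B -> D \in circuits M -> f \in D ->
  exists x K, [/\ x \in D :\: B, K \in circuits M, K \subset x |: B & f \in K].
Proof.
move=> bB fB cD fD; have iB := base_indep bB.
have [/existsP[x /andP[xDB ix]]|none] :=
  boolP [exists x, (x \in D :\: B) && (x |: (B :\ f) \in indep M)].
  have [xD xB] := setDP xDB; have [K cK sK] := base_circuit bB xB.
  exists x, K; split=> //; apply/negPn/negP => fK.
  apply: (circuitNindep cK ix); apply/subsetP=> y yK.
  have := subsetP sK y yK; rewrite !inE => /orP[->//|->].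
  by rewrite andbT orbC; apply/orP; left; apply: contraNneq fK => <-.
have /negP[] : dependent M (f |: B :\ f); last by rewrite setD1K.
apply: (@span_circuit _ (D :\ f) D) => //; last by rewrite setD11.
  by apply: indep_sub iB (subsetDl _ _).
move=> x /setD1P[xf xD]; rewrite !inE xf /= => xB; apply/negP => ix.
by case/existsP: none; exists x; rewrite inE xB xD.
Qed.

End Independence.

(** * Words over F_2 and their supports *)

Section Words.
Local Open Scope ring_scope.
Variable E : finType.
Local Notation word := {ffun E -> ('F_2)^o}.
Implicit Types (u v w : word) (A : {set E}) (x : E).

Definition supp v := [set x | v x != 0].

Lemma F2_neq0 (a : 'F_2) : a != 0 -> a = 1.
Proof. by case: a => -[|[|//]] // i _; apply: val_inj. Qed.

Lemma suppD u v x :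
  (x \in supp (u + v)) = (x \in supp u) (+) (x \in supp v).
Proof.
rewrite !inE ffunE.
have [->|/F2_neq0->] := eqVneq (u x) 0; first by rewrite add0r.
by have [->|/F2_neq0->] := eqVneq (v x) 0; rewrite ?addr0.
Qed.

Lemma supp_indicator A : supp (indicator A) = A.
Proof. by apply/setP=> x; rewrite inE ffunE; case: (x \in A). Qed.

Lemma supp_inj : injective supp.
Proof.
move=> u v /setP eq_uv; apply/ffunP=> x; have := eq_uv x; rewrite !inE.
have [->|/F2_neq0->] := eqVneq (u x) 0.
  by have [->|] := eqVneq (v x) 0.
by have [|/F2_neq0->] := eqVneq (v x) 0.
Qed.

Lemma supp0 : supp 0 = set0.
Proof. by apply/setP=> x; rewrite !inE ffunE eqxx. Qed.

(** At an element of exactly one of the C i in the combination, the sum has a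
    single nonzero term. *)
Lemma supp_unique_union (g : nat) (C : 'I_g -> {set E})
    (k : 'I_g -> 'F_2) :
  unique_union C [set i | k i != 0] \subset
    supp (\sum_i k i *: indicator (C i)).
Proof.
apply/subsetP=> x; rewrite inE => /cards1P[i Si].
have /andP[ki xi] : (k i != 0) && (x \in C i).
  by have /setP/(_ i) := Si; rewrite !inE eqxx.
rewrite inE sum_ffunE (bigD1 i) //= big1 => [|j ji].
  by rewrite addr0 !ffunE xi (F2_neq0 ki).
rewrite !ffunE; have /setP/(_ j) := Si; rewrite !inE (negPf ji).
have [->|_ /= ->] := eqVneq (k j) 0; first by rewrite scale0r.
by rewrite scaler0.
Qed.

End Words.

(** * Connected weak-map images of binary matroids *)

Section WeakMap.
Local Open Scope ring_scope.
Variables (E : finType) (M : matroid E).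
Local Notation word := {ffun E -> ('F_2)^o}.
Variable W : {vspace word}.
Hypothesis dimW : \dim W = corank M.
Hypothesis depW : forall w, w \in W -> w != 0 -> dependent M (supp w).
Implicit Types (A B D K : {set E}) (w : word).

Lemma word_indep0 w A :
  w \in W -> supp w \subset A -> A \in indep M -> w = 0.
Proof.
move=> wW sA iA; apply: contraTeq iA => w0.
exact: dependentS sA (depW wW w0).
Qed.

Definition restr A w : {ffun {x | x \in A} -> ('F_2)^o} :=
  [ffun x => w (val x)].

Fact restr_is_linear A : linear (restr A).
Proof. by move=> a u v; apply/ffunP=> x; rewrite !ffunE. Qed.
HB.instance Definition _ A :=
  GRing.isLinear.Build _ _ _ _ (restr A) (@restr_is_linear A).

(** Restriction of words to the complement of B is injective on W, because a
    word in its kernel is supported by the independent set B. Both sides have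
    dimension the corank, so restriction is onto. *)
Lemma fundamental_word B e : base M B -> e \notin B ->
  exists2 w, w \in W & supp w :\: B = [set e].
Proof.
move=> bB eB; pose f := linfun (restr (~: B)).
have kerf : (W :&: lker f)%VS = 0%VS.
  apply/eqP; rewrite -subv0; apply/subvP=> w /memv_capP[wW].
  rewrite memv_ker lfunE /= => /eqP fw; rewrite memv0; apply/eqP.
  apply: (word_indep0 wW _ (base_indep bB)); apply/subsetP=> x.
  rewrite inE; apply: contraR => xB.
  have xC : x \in ~: B by rewrite inE.
  by have /ffunP/(_ (Sub x xC)) := fw; rewrite !ffunE SubK => ->.
have fullf : (f @: W)%VS = fullv.
  apply/eqP; rewrite eqEdim subvf limg_dim_eq // dimW -(card_base bB) dimvf.
  by rewrite /dim /= card_sig muln1.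
have eC : e \in ~: B by rewrite inE.
have /memv_imgP[w wW fw] :
  [ffun x : {x | x \in ~: B} => (val x == e)%:R : ('F_2)^o] \in (f @: W)%VS.
  by rewrite fullf memvf.
exists w => //; apply/setP=> x; rewrite 3!inE.
have [xB|xB] /= := boolP (x \in B).
  by apply/esym/negbTE; apply: contraNneq eB => <-.
have xC : x \in ~: B by rewrite inE.
have /ffunP/(_ (Sub x xC)) := fw; rewrite lfunE !ffunE SubK => <-.
by case: (x == e).
Qed.

Lemma fundamental_sub w B e : supp w :\: B = [set e] -> supp w \subset e |: B.
Proof. by move=> swB; rewrite setUC -subDset swB. Qed.

(** An element b of K outside w would leave w supported by the base obtained
    from B by exchanging b for e. *)
Lemma circuit_sub_word B w e K :
    base M B -> w \in W -> supp w :\: B = [set e] ->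
    K \in circuits M -> K \subset e |: B ->
  K \subset supp w.
Proof.
move=> bB wW swB cK sK; have iB := base_indep bB.
have /setDP[ew eB] : e \in supp w :\: B by rewrite swB set11.
apply/subsetP=> b bK; apply: contraLR ew => bw.
rewrite (word_indep0 wW _ (circuit_exchange iB eB cK sK bK)) ?supp0 ?inE //.
by rewrite subsetD1 fundamental_sub.
Qed.

Hypothesis connM : connected M.

(** Here e is the element added to B, K its fundamental circuit, w its
    fundamental word, and D a circuit witnessing that e and f are connected.
    The induction lets the base vary as well as f, and it decreases the number
    of elements of D outside B. *)
Lemma fundamental_word_sub n B w e K D f :
    base M B -> w \in W -> supp w :\: B = [set e] ->
    K \in circuits M -> K \subset e |: B ->
    D \in circuits M -> e \in D -> f \in D -> (#|D :\: B| < n)%N ->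
  f \in supp w -> f \in K.
Proof.
elim: n B w e K D f => // n IHn B w e K D f bB wW swB cK sK cD eD fD leD fw.
apply/negPn/negP=> fK.
have iB := base_indep bB.
have [ew eB] : e \in supp w /\ e \notin B by apply/setDP; rewrite swB set11.
have sKw := circuit_sub_word bB wW swB cK sK.
have eK := base_circuitE bB cK sK.
have fe : f != e by apply: contraNneq fK => ->.
have fB : f \in B.
  by have := subsetP (fundamental_sub swB) f fw; rewrite !inE (negPf fe).
(* The fundamental circuit of e' contains f, while that of e does not. *)
have [e' [K' [e'DB cK' sK' fK']]] := circuit_through bB fB cD fD.
have [e'D e'B] := setDP e'DB.
have e'K' := base_circuitE bB cK' sK'.
have ee' : e != e'.
  apply: contraNneq fK => ee'; rewrite -ee' in e'B sK'.
  apply/negPn/negP=> fK.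
  apply: (circuitNindep cK (circuit_exchange iB e'B cK' sK' fK')).
  by rewrite subsetD1 sK fK.
have eK' : e \notin K'.
  by apply/negP=> /(subsetP sK'); rewrite !inE (negPf ee') (negPf eB).
have shrink A : A \subset (D :\: B) :\ e' -> (#|A| < n)%N.
  move=> sA; rewrite -ltnS; apply: leq_trans leD; rewrite ltnS.
  by rewrite (cardsD1 e' (D :\: B)) e'DB ltnS subset_leq_card.
(* D' trades e' for elements b of B on the fundamental circuit of e'. *)
have [D' [cD' eD' sD']] := strong_elimination cD cK' e'D e'K' eD eK'.
have /subsetPn[b bD' bD] : ~~ (D' \subset D).
  apply/negP=> sD'D; have := subsetP sD' e'.
  by rewrite (circuit_sub cD sD'D (circuit_dep cD')) e'D !inE eqxx => /(_ isT).
have [be' bK'] : b != e' /\ b \in K'.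
  by have := subsetP sD' b bD'; rewrite !inE (negPf bD) => /andP[].
have bB' : b \in B by have := subsetP sK' b bK'; rewrite !inE (negPf be').
have bf : b != f by apply: contraNneq bD => ->.
have be : b != e by apply: contraNneq bD => ->.
have [bw|bw] := boolP (b \in supp w); last first.
  have bK : b \notin K by apply: contra bw => /(subsetP sKw).
  have sub_pivot A : A \subset e |: B -> b \notin A ->
      A \subset e |: (e' |: B) :\ b.
    move=> sA bA; apply/subsetP=> y yA; have := subsetP sA y yA.
    rewrite !inE; case: eqP => //= _ ->; rewrite orbT andbT.
    by apply: contraNneq bA => <-.
  (* Exchanging b for e' in B leaves w and K fundamental for e, and brings
     the element e' of D into the base. *)
  apply: (negP fK); apply: (IHn ((e' |: B) :\ b) w e K D f) => //.
  - exact: base_exchange cK' sK' bK'.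
  - apply/eqP; rewrite eqEsubset sub1set inE ew andbT.
    rewrite subDset setUC sub_pivot ?fundamental_sub //=.
    by rewrite !inE (negPf eB) (negPf ee') andbF.
  - exact: sub_pivot.
  - apply: shrink; apply/subsetP=> y /setDP[yD]; rewrite !inE yD.
    have -> /= : y != b by apply: contraNneq bD => <-.
    by rewrite negb_or andbT.
have [bK|bK] := boolP (b \in K); last first.
  (* Now b, like f, is in w but not in K, and D' contains e and b. *)
  apply: (negP bK); apply: (IHn B w e K D' b) => //; apply: shrink.
  apply/subsetP=> y /setDP[/(subsetP sD')]; rewrite !inE => /andP[ye' yDK'] yB.
  rewrite ye' yB; case/orP: yDK' => [->//|/(subsetP sK')].
  by rewrite !inE (negPf yB) (negPf ye').
(* Exchanging f for e' and then b for e is possible in M, but the sum of the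
   two fundamental words vanishes at both b and f. *)
have [w' w'W sw'B] := fundamental_word bB e'B.
have sK'w' := circuit_sub_word bB w'W sw'B cK' sK'.
have iB1 := circuit_exchange iB e'B cK' sK' fK'.
have eB1 : e \notin (e' |: B) :\ f.
  by rewrite !inE (negPf eB) (negPf ee') andbF.
have sKB1 : K \subset e |: (e' |: B) :\ f.
  apply/subsetP=> y yK; have := subsetP sK y yK; rewrite !inE.
  case: eqP => //= _ ->; rewrite orbT andbT.
  by apply: contraNneq fK => <-.
have iB2 := circuit_exchange iB1 eB1 cK sKB1 bK.
have w0 : w + w' = 0.
  apply: (word_indep0 _ _ iB2); first exact: rpredD.
  apply/subsetP=> y; rewrite suppD => yww'.
  have [nyb nyf] : y != b /\ y != f.
    split; apply: contraTneq yww' => ->; first by rewrite bw (subsetP sK'w').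
    by rewrite fw (subsetP sK'w').
  have : (y \in supp w) || (y \in supp w').
    by case: (y \in supp w) yww'.
  rewrite !inE nyb nyf /= => /orP[yw|yw'].
    have := subsetP (fundamental_sub swB) y; rewrite !inE => /(_ yw).
    by case/orP=> ->; rewrite ?orbT.
  have := subsetP (fundamental_sub sw'B) y; rewrite !inE => /(_ yw').
  by move=> ->; rewrite orbT.
have ew' : e \notin supp w'.
  apply/negP=> /(subsetP (fundamental_sub sw'B)).
  by rewrite !inE (negPf eB) (negPf ee').
by have := suppD w w' e; rewrite w0 supp0 ew (negPf ew') inE.
Qed.

Lemma fundamental_wordE B w e K :
    base M B -> w \in W -> supp w :\: B = [set e] ->
    K \in circuits M -> K \subset e |: B ->
  w = indicator K.
Proof.
move=> bB wW swB cK sK; apply: supp_inj; rewrite supp_indicator.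
apply/eqP; rewrite eqEsubset (circuit_sub_word bB wW swB cK sK) andbT.
apply/subsetP=> f fw.
have [<-|ef] := eqVneq e f; first exact: base_circuitE bB cK sK.
have [D cD /andP[eD fD]] := connM ef.
exact: fundamental_word_sub bB wW swB cK sK cD eD fD (ltnSn _) fw.
Qed.

Lemma circuit_word D : D \in circuits M -> indicator D \in W.
Proof.
move=> cD; have /set0Pn[e eD] : D != set0.
  apply: contraTneq cD => ->; apply/negP=> /circuit_dep/negP.
  by rewrite indep_set0.
have [B bB sDB] := base_extend (circuitD1_indep cD eD).
have sD : D \subset e |: B by rewrite -(setD1K eD) setUS.
have eB : e \notin B.
  apply/negP=> eB; apply: (circuitNindep cD (base_indep bB)).
  by rewrite -(setD1K eD) subUset sub1set eB.
have [w wW swB] := fundamental_word bB eB.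
by rewrite -(fundamental_wordE bB wW swB cD sD).
Qed.

(** For the inclusion of W in the circuit space, adding to a word the
    fundamental circuit of one of its elements outside a fixed base B removes
    that element and no other from outside B; a word inside B is zero. *)
Lemma weak_map_circuit_space : W = circuit_space M.
Proof.
have sub_circ : (circuit_space M <= W)%VS.
  apply/span_subvP=> _ /imageP[D cD ->]; exact: circuit_word.
apply/eqP; rewrite eqEsubv sub_circ andbT; apply/subvP.
have [B bB _] := base_extend (indep_set0 M).
move=> w; move Dn: #|supp w :\: B| => n; elim: n w Dn => [|n IHn] w Dn wW.
  rewrite (word_indep0 wW _ (base_indep bB)) ?rpred0 //.
  by rewrite -setD_eq0 -cards_eq0 Dn.
have /set0Pn[e ewB] : supp w :\: B != set0 by rewrite -card_gt0 Dn.
have [ew eB] := setDP ewB.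
have [K cK sK] := base_circuit bB eB.
have KC : indicator K \in circuit_space M.
  by apply/memv_span/imageP; exists K.
rewrite -(addrK (indicator K) w) rpredB //; apply: IHn; last first.
  by rewrite rpredD //; apply: subvP KC.
have -> : supp (w + indicator K) :\: B = (supp w :\: B) :\ e.
  apply/setP=> x; rewrite in_setD suppD supp_indicator in_setD1 in_setD.
  have [xB|xB] /= := boolP (x \in B); first by rewrite andbF.
  have -> : (x \in K) = (x == e).
    apply/idP/eqP=> [/(subsetP sK)|->]; last exact: base_circuitE bB cK sK.
    by rewrite !inE (negPf xB) orbF => /eqP.
  by have [->|_] := eqVneq x e; rewrite ?ew ?addbF.
by move: Dn; rewrite (cardsD1 e) ewB => -[].
Qed.

End WeakMap.

(** * The span of a cycle system *)

Section CycleSystem.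
Local Open Scope ring_scope.
Variables (E : finType) (M : matroid E) (g : nat) (C : 'I_g -> {set E}).
Hypothesis depC :
  forall S : {set 'I_g}, S != set0 -> dependent M (unique_union C S).

Let X := [tuple indicator (C i) | i < g].

Lemma combination_dependent (k : 'I_g -> 'F_2) i :
  k i != 0 -> dependent M (supp (\sum_i k i *: indicator (C i))).
Proof.
move=> ki; apply: dependentS (supp_unique_union C k) (depC _).
by apply/set0Pn; exists i; rewrite inE.
Qed.

Lemma cycle_system_free : free X.
Proof.
apply/freeP=> k k0 i; apply/eqP; apply/negPn/negP=> ki.
have /negP := combination_dependent ki; apply.
have -> : \sum_i k i *: indicator (C i) = 0.
  by rewrite -[RHS]k0; apply: eq_bigr => j _; rewrite -tnth_nth tnth_mktuple.
by rewrite supp0 indep_set0.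
Qed.

Lemma cycle_system_span_dependent w :
  w \in <<X>>%VS -> w != 0 -> dependent M (supp w).
Proof.
move=> /coord_span Dw; rewrite Dw; set k := fun i => coord X i w.
have [/existsP[i ki] _|none] := boolP [exists i, k i != 0].
  have -> : \sum_(i < g) coord X i w *: X`_i = \sum_i k i *: indicator (C i).
    by apply: eq_bigr => j _; rewrite -tnth_nth tnth_mktuple.
  exact: combination_dependent ki.
rewrite big1 ?eqxx // => i _; have /existsPn/(_ i)/negPn/eqP ki0 := none.
by rewrite -/(k i) ki0 scale0r.
Qed.

End CycleSystem.

Theorem corollary4p4 (E : finType) (M : matroid E) (g : nat)
    (C : 'I_g -> {set E}) :
  connected M -> cycle_system M C ->
  basis_of (circuit_space M) [seq indicator (C i) | i : 'I_g].
Proof.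
move=> connM [Dg _ depC].
have freeC := cycle_system_free depC.
rewrite -[image _ _]/(val [tuple indicator (C i) | i < g]).
rewrite /basis_of freeC andbT; apply/eqP; apply: weak_map_circuit_space => //.
  by rewrite (eqnP freeC) size_tuple.
exact: cycle_system_span_dependent.
Qed.
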